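(* Let $(\Omega,\mu)$ be a finite probability space, $r,\gamma>0$, $q\ge2$, and let $f\colon\Omega^n\to\mathbb{R}$ be $(r,\gamma)$-$L_2$-global. Let $0<\rho'\le1/3$, let $\rho=\rho'/\sqrt{2q}$, and suppose $\beta=\rho'\left(1+\frac{2(q-2)}{\log(1/\rho')}\right)$ satisfies $\beta\le\sqrt q\,(r/\sqrt2)^{-\frac{q-2}{q}}$. Then $\|T_\rho f\|_q^q\le\|f\|_2^2\gamma^{q-2}$.
   Context: Norms w.r.t. $\mu^n$; $\log$ natural. $T_\rho f(x)=\mathbb{E}_y f(y)$ where $y$ keeps each $x_i$ independently with probability $\rho$ and otherwise resamples it from $\mu$. For $i\in[n]$, $E_i$ averages over coordinate $i$ according to $\mu$, $L_i=I-E_i$, $L_S=\prod_{i\in S}L_i$, $D_{S,x}f=(L_Sf)_{S\to x}$ with $h_{S\to x}(y)=h(x,y)$. $f$ is $(r,\gamma)$-$L_2$-global if $\|D_{S,x}f\|_2\le r^{|S|}\gamma$ for all $S\subseteq[n]$ and $x\in\Omega^S$. *)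

(* Defs.v *)
From HB Require Import structures.
From mathcomp Require Import all_boot all_order all_algebra.
From mathcomp Require Import reals exp.
Set Implicit Arguments. Unset Strict Implicit. Unset Printing Implicit Defensive.
Import Order.TTheory GRing.Theory Num.Theory.
Local Open Scope ring_scope.

Section Defs.
Variables (R : realType) (Omega : finType) (mu : Omega -> R) (n : nat).

Definition pt := {ffun 'I_n -> Omega}.

Definition mun (x : pt) : R := \prod_(i < n) mu (x i).

Definition Exp (f : pt -> R) : R := \sum_(x : pt) mun x * f x.

Definition norm2 (f : pt -> R) : R := Num.sqrt (Exp (fun x => f x ^+ 2)).

Definition normq_pow (q : R) (f : pt -> R) : R := Exp (fun x => `|f x| `^ q).

(* noise operator: y_i = x_i w.p. rho, otherwise resampled from mu *)
Definition Trho (rho : R) (f : pt -> R) (x : pt) : R :=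
  \sum_(y : pt) (\prod_(i < n) (rho * (x i == y i)%:R + (1 - rho) * mu (y i))) * f y.

Definition upd (x : pt) (i : 'I_n) (a : Omega) : pt :=
  [ffun j => if j == i then a else x j].

Definition Ei (i : 'I_n) (f : pt -> R) (x : pt) : R := \sum_(a : Omega) mu a * f (upd x i a).
Definition Li (i : 'I_n) (f : pt -> R) (x : pt) : R := f x - Ei i f x.
Definition LS (S : {set 'I_n}) (f : pt -> R) : pt -> R := foldr Li f (enum S).

Definition merge (S : {set 'I_n}) (x z : pt) : pt :=
  [ffun j => if j \in S then x j else z j].

(* D_{S,x} f, viewed as a function on Omega^n not depending on the coordinates in S *)
Definition DSx (S : {set 'I_n}) (x : pt) (f : pt -> R) : pt -> R :=
  fun z => LS S f (merge S x z).

Definition L2_global (r gamma : R) (f : pt -> R) : Prop :=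
  forall (S : {set 'I_n}) (x : pt), norm2 (DSx S x f) <= r ^+ #|S| * gamma.

Definition prob_space : Prop := (forall a, 0 <= mu a) /\ \sum_(a : Omega) mu a = 1.

End Defs.

(* Main.v *)
(** By homogeneity, [E|a + s W|^q <= (|a|^2 + q E|W|^2)^(q/2) + b^q E|W|^q] for a mean-zero
    [W] with values in a Hilbert space, where [b = s (1 + 2 (q - 2) / log (1/s))]: for small
    [|W|] the left side is controlled by a second-order expansion, for large [|W|] the term
    [b^q |W|^q] alone dominates [(|a| + s |W|)^q].  Substituting [W = X / sqrt (2 q)] turns
    [q E|W|^2] into [E|X|^2 / 2], the effect of noise of rate [1 / sqrt 2] in [L2].

    Each coordinate is treated in turn: it either joins the set [B] of coordinates over
    which an inner [L2] norm is taken (with noise [1 / sqrt 2]), or the set [S] on which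
    the Laplacian is applied, at the cost of a factor [c].  Once all coordinates
    are consumed, globalness bounds the inner norm by [r^|S| gamma], the hypothesis on [b] says
    [c r^(q-2) <= 1/2], and the remaining sum
    [\sum_S 2^-|S| |T_(1/sqrt 2) L_S f|_2^2] with noise on the coordinates
    outside [S] only, is [|f|_2^2] by Parseval. *)

Require Import Defs.
From HB Require Import structures.
From mathcomp Require Import all_boot all_order all_algebra.
From mathcomp Require Import boolp reals sequences exp.
From mathcomp Require Import ring lra.
Import Order.TTheory GRing.Theory Num.Theory.
Local Open Scope ring_scope.

Section GlobalHypercontractivity.
Variable R : realType.

(** * Real powers and the scalar form of the moment inequality *)

Section RealPowers.
Implicit Types a b p q k x y t : R.

(** Young's inequality for [b] and a^(p-1) with exponents p and p/(p-1); p = 1, where the second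
    exponent degenerates, is separate. *)
Lemma powR_tangent p a b : 1 <= p -> 0 <= a -> 0 <= b ->
  a `^ p + p * a `^ (p - 1) * (b - a) <= b `^ p.
Proof.
move=> p1 a0 b0.
have [->|pn1] := eqVneq p 1; first by rewrite subrr powRr0 !powRr1 //; lra.
have pg1 : 0 < p - 1 by rewrite subr_gt0 lt_neqAle eq_sym pn1.
have p0 : 0 < p by lra.
have := @conjugate_powR R b (a `^ (p - 1)) p (p / (p - 1)) b0 (powR_ge0 _ _) p0
  (divr_gt0 p0 pg1).
have pn0 : p != 0 by rewrite gt_eqF.
have pn1' : p - 1 != 0 by rewrite gt_eqF.
move=> /(_ _)/wrap[]; first by field; rewrite pn0 pn1'.
rewrite -powRrM (_ : (p - 1) * (p / (p - 1)) = p); last by field.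
rewrite -(mulr_powRB1 a0 p0) -(ler_pM2l p0).
rewrite (_ : p * (b `^ p / p + _) = b `^ p + (p - 1) * (a * a `^ (p - 1))); last first.
  by field; rewrite pn0 pn1'.
lra.
Qed.

Lemma powR_sub1_le a k : 1 <= a -> 0 <= k -> a `^ k - 1 <= k * (a - 1) * a `^ k.
Proof.
move=> a1 k0; have a0 : 0 < a by lra.
rewrite /powR gt_eqF //; set l := ln a.
have la : l <= a - 1.
  by have := @le_ln1Dx R (a - 1); rewrite /l (_ : 1 + (a - 1) = a); [apply; lra|ring].
have E0 := expR_gt0 (k * l).
have h : 1 - k * (a - 1) <= expR (- (k * l)).
  apply: le_trans (expR_ge1Dx _); nra.
have := ler_wpM2r (ltW E0) h; rewrite -expRD addNr expR0; lra.
Qed.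

(** The tangent at 1 gives the constant k when k >= 1, and a^k >= a gives 1 when k <= 1; k + 1
    covers both. *)
Lemma one_sub_powR_le a k : 0 <= a -> a <= 1 -> 0 <= k ->
  1 - a `^ k <= (k + 1) * (1 - a).
Proof.
move=> a0 a1 k0; have [k1|/ltW k1] := leP 1 k.
  have := powR_tangent k 1 a k1 ler01 a0; rewrite !powR1; nra.
have := powR_ge0 a k; have [->|an0] := eqVneq a 0; first by lra.
have := @ger1_powR R a k; rewrite lt_neqAle eq_sym an0 a0 a1 => /(_ isT k1); nra.
Qed.

(** Small-deviation regime. Here [a] stands for the norm of a unit vector plus a vector of norm [x],
    so a^2 - 1 - x^2 is twice their inner product and the linear term stays exact. *)
Lemma powR_le_quadratic q a x Z : 2 <= q -> 0 <= a -> 0 <= x -> `|a - 1| <= x ->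
  3 <= Z -> (1 + x) `^ (q - 2) <= Z -> (q - 2) * x <= Z / 2 ->
  a `^ q <= 1 + q / 2 * (a ^+ 2 - 1 - x ^+ 2) + q ^+ 2 / 2 * (Z ^+ 2 * x ^+ 2).
Proof.
move=> q2 a0 x0 ax Z3 MZ kxZ.
set w := a `^ (q - 2).
have w0 : 0 <= w by exact: powR_ge0.
have sq (s : R) : (a ^+ 2) `^ s = a `^ (2 * s) by rewrite -powR_mulrn // -powRrM.
have T := powR_tangent (q / 2) (a ^+ 2) 1.
rewrite !sq powR1 (_ : 2 * (q / 2) = q) in T; last by field.
rewrite (_ : 2 * (q / 2 - 1) = q - 2) in T; last by field.
have {T} := T _ (sqr_ge0 _) ler01; rewrite -/w => /(_ _)/wrap[]; first by lra.
(* The tangent to u^(q/2) at a^2 gives a^q <= 1 + (q/2)(a^2 - 1)w. Writing w = 1 + (w - 1) isolates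
   a product of two factors of the same sign, both vanishing at a = 1. *)
suff H : (a ^+ 2 - 1) * (w - 1) <= x ^+ 2 * (q * Z ^+ 2 - 1).
  have := ler_wpM2l (_ : 0 <= q / 2) H => /(_ _)/wrap[]; first by lra.
  move: (a `^ q) => Q; lra.
have [a1|/ltW a1] := leP 1 a.
  have ax' : a - 1 <= x by rewrite ger0_norm in ax => //; lra.
  have wZ : w <= Z.
    apply: le_trans MZ; apply: ge0_ler_powR; rewrite ?nnegrE; lra.
  have S := powR_sub1_le a (q - 2) a1 (_ : 0 <= q - 2); rewrite -/w in S.
  have {}S : w - 1 <= (q - 2) * (a - 1) * Z.
    apply: le_trans (S _) _; first lra.
    apply: ler_wpM2l => //; apply: mulr_ge0; lra.
  have H1 : (a ^+ 2 - 1) * (w - 1) <= (a ^+ 2 - 1) * ((q - 2) * (a - 1) * Z).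
    apply: ler_wpM2l => //; nra.
  apply: (le_trans H1).
  have H2 : (a - 1) ^+ 2 <= x ^+ 2 by rewrite ler_sqr ?nnegrE //; lra.
  have H3 : (a + 1) * ((q - 2) * Z) <= q * Z ^+ 2 - 1.
    have : (a + 1) * (q - 2) <= 2 * (q - 2) + Z / 2 by nra.
    move=> /(ler_wpM2r (_ : 0 <= Z)) => /(_ _)/wrap[]; first by lra.
    have : 3 * (q * Z) <= Z * (q * Z) by apply: ler_wpM2r => //; nra.
    have : 2 * Z ^+ 2 <= q * Z ^+ 2 by apply: ler_wpM2r => //; nra.
    nra.
  rewrite (_ : _ * _ = (a - 1) ^+ 2 * ((a + 1) * ((q - 2) * Z))); last by ring.
  apply: ler_pM => //; first exact: sqr_ge0.
  by rewrite !mulr_ge0 //; lra.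
have ax' : 1 - a <= x by rewrite ler0_norm in ax => //; lra.
have S := one_sub_powR_le a (q - 2) a0 a1 (_ : 0 <= q - 2); rewrite -/w in S.
have {}S : 1 - w <= (q - 1) * x by apply: le_trans (S _) _; [lra|nra].
have H1 : (1 - a ^+ 2) * (1 - w) <= (1 - a ^+ 2) * ((q - 1) * x).
  apply: ler_wpM2l => //; nra.
have H2 : (1 - a ^+ 2) * ((q - 1) * x) <= 2 * x * ((q - 1) * x).
  by apply: ler_wpM2r; nra.
have H3 : 2 * (q - 1) <= q * Z ^+ 2 - 1.
  have : 9 <= Z ^+ 2 by nra.
  nra.
have := ler_wpM2r (sqr_ge0 x) H3; lra.
Qed.

(** Here [y] is the squared norm of a unit vector plus a vector of norm [x], and [t] is their inner
    product. Below the threshold (q-2)x = ln Z / 2 the quadratic bound applies; above it 1 + x is at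
    most x times the factor in the last term. *)
Lemma powR_normalized_le q Z x t y : 2 <= q -> 3 <= Z -> 0 <= x ->
  t ^+ 2 <= x ^+ 2 -> y = 1 + 2 * t + x ^+ 2 ->
  y `^ (q / 2) <= 1 + q * t + q ^+ 2 / 2 * (Z ^+ 2 * x ^+ 2)
                  + (1 + 2 * (q - 2) / ln Z) `^ q * x `^ q.
Proof.
move=> q2 Z3 x0 tx yE.
have Z0 : 0 < Z by lra.
have L0 : 0 < ln Z by apply: ln_gt0; lra.
have B0 : 0 <= 2 * (q - 2) / ln Z by apply: divr_ge0; lra.
have {}B0 : 0 <= 1 + 2 * (q - 2) / ln Z by lra.
set B := 1 + _ in B0 *.
have txa : `|t| <= x by rewrite -(ger0_norm x0) -ler_sqr ?nnegrE // !real_normK // num_real.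
have [t1 t2] : - x <= t /\ t <= x by apply/andP; rewrite -ler_norml.
have y0 : 0 <= y by rewrite yE; have := sqr_ge0 (1 - x); nra.
pose a := Num.sqrt y.
have a0 : 0 <= a by exact: sqrtr_ge0.
have aE : a ^+ 2 = y by rewrite sqr_sqrtr.
have -> : y `^ (q / 2) = a `^ q.
  rewrite -aE -powR_mulrn // -powRrM; congr powR; lra.
have a1x : a <= 1 + x by rewrite -ler_sqr ?nnegrE ?aE ?yE //; [nra|lra].
have [kx|kx] := leP ((q - 2) * x) (ln Z / 2).
  have LZ : ln Z <= Z by exact/ltW/ln_sublinear.
  have ax : `|a - 1| <= x.
    rewrite ler_norml; apply/andP; split; last lra.
    have [x1|x1] := leP 1 x; first lra.
    suff: 1 - x <= a by lra.
    by rewrite -ler_sqr ?nnegrE ?aE ?yE //; [nra|lra].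
  have M : (1 + x) `^ (q - 2) <= Z.
    rewrite -[leRHS](lnK Z0) /powR gt_eqF; last lra.
    rewrite ler_expR; have lx := @le_ln1Dx R x; have {}lx := lx (_ : -1 < x).
    apply: (@le_trans _ _ ((q - 2) * x)); last lra.
    by apply: ler_wpM2l; [lra|apply: lx; lra].
  have := powR_le_quadratic q a x Z q2 a0 x0 ax Z3 M.
  rewrite aE yE => /(_ _)/wrap[]; first lra.
  have : 0 <= B `^ q * x `^ q by rewrite mulr_ge0 ?powR_ge0.
  move: (B `^ q * x `^ q) (a `^ q) => u v; lra.
have xB : 1 + x <= B * x.
  rewrite mulrDl mul1r addrC lerD2l -mulrAC ler_pdivlMr //; lra.
have : a `^ q <= B `^ q * x `^ q.
  rewrite -powRM //; apply: ge0_ler_powR; rewrite ?nnegrE; [lra|lra|nra|lra].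
(* The other terms may be dropped: t >= -x and Z >= 3 leave at least 1 - qx + (9/2)q^2 x^2, which is
   nonnegative. *)
have : 0 <= 1 + q * t + q ^+ 2 / 2 * (Z ^+ 2 * x ^+ 2).
  have h1 : 9 * x ^+ 2 <= Z ^+ 2 * x ^+ 2 by apply: ler_wpM2r; nra.
  have h2 : q ^+ 2 * (9 * x ^+ 2) <= q ^+ 2 * (Z ^+ 2 * x ^+ 2).
    by apply: ler_wpM2l => //; exact: sqr_ge0.
  have : q * (- x) <= q * t by apply: ler_wpM2l; lra.
  nra.
move: (B `^ q * x `^ q) (a `^ q) => u v; lra.
Qed.

(** Divide by [A] and take x = s sqrt(D/A), t = sC/A, Z = 1/s. This [Z] makes Z^2 x^2 = D/A, so the
    quadratic term is free of [s]. *)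
Lemma powR_sum_le q s A C D : 2 <= q -> 0 < s -> s <= 1 / 3 ->
  0 <= A -> 0 <= D -> C ^+ 2 <= A * D ->
  (A + 2 * s * C + s ^+ 2 * D) `^ (q / 2) <=
    A `^ (q / 2) + A `^ (q / 2 - 1) * (q * s * C + q ^+ 2 / 2 * D)
    + (s * (1 + 2 * (q - 2) / ln (1 / s))) `^ q * D `^ (q / 2).
Proof.
move=> q2 s0 s3 A0 D0 CAD.
have Z3 : 3 <= 1 / s by rewrite ler_pdivlMr //; lra.
have L0 : 0 < ln (1 / s) by apply: ln_gt0; lra.
have B1 : 0 <= 2 * (q - 2) / ln (1 / s) by apply: divr_ge0; lra.
have {}B1 : 1 <= 1 + 2 * (q - 2) / ln (1 / s) by lra.
set B := 1 + _ in B1 *.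
have sq (x u : R) : 0 <= x -> (x ^+ 2) `^ u = x `^ (2 * u).
  by move=> x0; rewrite -powR_mulrn // -powRrM.
have q2q : 2 * (q / 2) = q by field.
have [Ae|An] := eqVneq A 0.
  have Ce : C = 0.
    by apply/eqP; rewrite -sqrf_eq0 eq_le sqr_ge0 andbT; move: CAD; rewrite Ae mul0r.
  rewrite Ae Ce powR0 ?mulr0 ?add0r; last by rewrite gt_eqF //; lra.
  rewrite powRM ?sqr_ge0 // sq ?(ltW s0) // q2q.
  (* At q = 2 the factor 0^(q/2-1) equals 1, so the middle term need not vanish and is only bounded
     below by 0. *)
  apply: ler_wpDl.
    by rewrite mulr_ge0 ?powR_ge0 // mulr_ge0 // divr_ge0 ?sqr_ge0.
  apply: ler_wpM2r; first exact: powR_ge0.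
  apply: ge0_ler_powR; rewrite ?nnegrE; [lra|lra| |]; nra.
have Ag : 0 < A by rewrite lt_neqAle eq_sym An.
pose x := s * Num.sqrt (D / A).
have DA0 : 0 <= D / A by rewrite divr_ge0.
have x0 : 0 <= x by rewrite mulr_ge0 ?sqrtr_ge0 // ltW.
have x2 : x ^+ 2 = s ^+ 2 * (D / A) by rewrite exprMn sqr_sqrtr.
have xq : x `^ q = s `^ q * (D / A) `^ (q / 2).
  rewrite /x powRM ?sqrtr_ge0 ?(ltW s0) //; congr (_ * _).
  by rewrite -[in LHS]q2q -sq ?sqrtr_ge0 // sqr_sqrtr.
have tx : (s * C / A) ^+ 2 <= x ^+ 2.
  rewrite x2 !exprMn -mulrA; apply: ler_wpM2l; first exact: sqr_ge0.
  have -> : D / A = A * D * A^-1 ^+ 2 by field.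
  by apply: ler_wpM2r => //; exact: sqr_ge0.
have := powR_normalized_le q (1 / s) x (s * C / A) _ q2 Z3 x0 tx erefl.
rewrite -/B xq => H.
have -> : A + 2 * s * C + s ^+ 2 * D = A * (1 + 2 * (s * C / A) + x ^+ 2).
  by rewrite x2; field.
rewrite powRM //; last by apply: le_trans (_ : (1 + s * C / A) ^+ 2 <= _); [exact: sqr_ge0|nra].
apply: le_trans (ler_wpM2l (powR_ge0 _ _) H) _.
rewrite (powRM _ (ltW s0)); last lra.
have -> : D `^ (q / 2) = A `^ (q / 2) * (D / A) `^ (q / 2).
  by rewrite -powRM //; congr powR; field.
have -> : A `^ (q / 2) = A * A `^ (q / 2 - 1) by rewrite mulr_powRB1 //; lra.
rewrite x2 le_eqVlt; apply/orP; left; apply/eqP; field.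
by rewrite An gt_eqF.
Qed.

End RealPowers.

(** * Averaging, Laplacian and noise in single coordinates *)

Section Operators.
Variables (Omega : finType) (mu : Omega -> R) (n : nat).
Hypotheses (mu_ge0 : forall a, 0 <= mu a) (mu_sum1 : \sum_a mu a = 1).
Implicit Types (f g h F G : pt Omega n -> R) (x y z : pt Omega n).
Implicit Types (i j : 'I_n) (l B S : seq 'I_n).

(** A common form for [noise] and [Li] (coefficients 1 and -1), so that their commutations all
    follow from [affEC]. *)
Definition affE (a b : R) i f x := a * f x + b * Ei mu i f x.
Definition noise (s : R) := affE s (1 - s).
(** Applied to a square, this is the squared norm of the inner Hilbert space, the coordinates
    outside [l] being frozen. *)
Definition EL l F := foldr (@Ei R Omega mu n) F l.

Lemma upd_upd x i a b : upd (upd x i a) i b = upd x i b.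
Proof. by apply/ffunP => j; rewrite !ffunE; case: eqP. Qed.

Lemma updC x i j a b : i != j -> upd (upd x i a) j b = upd (upd x j b) i a.
Proof.
move=> ij; apply/ffunP => k; rewrite !ffunE.
by case: eqP => // ->; rewrite eq_sym (negbTE ij).
Qed.

Lemma upd_id x i : upd x i (x i) = x.
Proof. by apply/ffunP => j; rewrite ffunE; case: eqP => // ->. Qed.

Lemma EiC i j F : Ei mu i (Ei mu j F) = Ei mu j (Ei mu i F).
Proof.
have [->//|ij] := eqVneq i j.
apply: funext => x; rewrite /Ei.
under eq_bigr do rewrite mulr_sumr.
under [RHS]eq_bigr do rewrite mulr_sumr.
rewrite exchange_big /=; apply: eq_bigr => a _; apply: eq_bigr => b _.
by rewrite updC // mulrCA.
Qed.

Lemma EiD i F G : Ei mu i (fun x => F x + G x) = fun x => Ei mu i F x + Ei mu i G x.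
Proof. by apply: funext => x; rewrite -big_split; apply: eq_bigr => a _; rewrite mulrDr. Qed.

Lemma EiZ i k F : Ei mu i (fun x => k * F x) = fun x => k * Ei mu i F x.
Proof. by apply: funext => x; rewrite /Ei mulr_sumr; apply: eq_bigr => a _; rewrite mulrCA. Qed.

Lemma Ei_mull i F G x : (forall y a, F (upd y i a) = F y) ->
  Ei mu i (fun y => F y * G y) x = F x * Ei mu i G x.
Proof. by move=> Fi; rewrite /Ei mulr_sumr; apply: eq_bigr => a _; rewrite Fi mulrCA. Qed.

Lemma Ei_invariant i F x : (forall y a, F (upd y i a) = F y) -> Ei mu i F x = F x.
Proof.
move=> Fi; rewrite /Ei; under eq_bigr do rewrite Fi.
by rewrite -mulr_suml mu_sum1 mul1r.
Qed.

Lemma Ei_upd i F x a : Ei mu i F (upd x i a) = Ei mu i F x.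
Proof. by apply: eq_bigr => b _; rewrite upd_upd. Qed.

Lemma Ei_le i F G x : (forall y, F y <= G y) -> Ei mu i F x <= Ei mu i G x.
Proof. by move=> FG; apply: ler_sum => a _; apply: ler_wpM2l. Qed.

Lemma Ei_upd_invariant i j F : (forall y a, F (upd y i a) = F y) ->
  forall y a, Ei mu j F (upd y i a) = Ei mu j F y.
Proof.
move=> Fi y a; have [->|ij] := eqVneq i j; first by rewrite Ei_upd.
by apply: eq_bigr => b _; rewrite updC // Fi.
Qed.

Lemma Ei_Li i F x : Ei mu i (Li mu i F) x = 0.
Proof.
rewrite /Li (_ : (fun y => _) = fun y => F y + (-1) * Ei mu i F y); last first.
  by apply: funext => y; rewrite mulN1r.
rewrite EiD EiZ [Ei mu i (Ei mu i F) x]Ei_invariant; last exact: Ei_upd.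
by rewrite mulN1r subrr.
Qed.

Lemma affEC a b i c d j f :
  affE a b i (affE c d j f) = affE c d j (affE a b i f).
Proof.
apply: funext => x; rewrite /affE !EiD !EiZ EiC; ring.
Qed.

Lemma LiE i f : Li mu i f = affE 1 (-1) i f.
Proof. by apply: funext => x; rewrite /affE mul1r mulN1r. Qed.

Lemma noiseE s i f x : noise s i f x = Ei mu i f x + s * Li mu i f x.
Proof. by rewrite /noise /affE /Li; ring. Qed.

Lemma foldr_commute (T I : Type) (op : T -> T) (g : I -> T -> T) :
  (forall k u, op (g k u) = g k (op u)) ->
  forall u s, op (foldr g u s) = foldr g (op u) s.
Proof. by move=> opg u; elim=> //= k s <-; rewrite opg. Qed.

Lemma Ei_EL i l F : Ei mu i (EL l F) = EL l (Ei mu i F).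
Proof. by apply: foldr_commute => k u; exact: EiC. Qed.

Lemma ELD l F G : EL l (fun x => F x + G x) = fun x => EL l F x + EL l G x.
Proof. by elim: l => //= i l ->; rewrite EiD. Qed.

Lemma ELZ l k F : EL l (fun x => k * F x) = fun x => k * EL l F x.
Proof. by elim: l => //= i l ->; rewrite EiZ. Qed.

Lemma EL_le l F G : (forall x, F x <= G x) -> forall x, EL l F x <= EL l G x.
Proof. by move=> FG; elim: l => //= i l IH x; apply: Ei_le. Qed.

Lemma EL_ge0 l F : (forall x, 0 <= F x) -> forall x, 0 <= EL l F x.
Proof.
move=> F0; elim: l => //= i l IH x.
by apply: sumr_ge0 => a _; apply: mulr_ge0.
Qed.

Lemma EL_upd_invariant l i F : (forall y a, F (upd y i a) = F y) ->
  forall y a, EL l F (upd y i a) = EL l F y.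
Proof. by move=> Fi; elim: l => //= j l IH; apply: Ei_upd_invariant. Qed.

Lemma EL_sqrD l u v k x :
  EL l (fun y => (u y + k * v y) ^+ 2) x =
  EL l (fun y => u y ^+ 2) x + 2 * k * EL l (fun y => u y * v y) x
  + k ^+ 2 * EL l (fun y => v y ^+ 2) x.
Proof.
rewrite (_ : (fun y => (u y + k * v y) ^+ 2) =
  fun y => u y ^+ 2 + 2 * k * (u y * v y) + k ^+ 2 * v y ^+ 2).
  by rewrite !ELD !ELZ.
by apply: funext => y; ring.
Qed.

(** Discriminant argument for the nonnegative polynomial A + 2kC + k^2 D in k. *)
Lemma EL_CauchySchwarz l u v x :
  EL l (fun y => u y * v y) x ^+ 2 <=
  EL l (fun y => u y ^+ 2) x * EL l (fun y => v y ^+ 2) x.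
Proof.
set A := EL l (fun y => u y ^+ 2) x; set D := EL l (fun y => v y ^+ 2) x.
set C := EL l _ x.
have P k : 0 <= A + 2 * k * C + k ^+ 2 * D.
  by rewrite -EL_sqrD; apply: EL_ge0 => y; exact: sqr_ge0.
have A0 : 0 <= A by apply: EL_ge0 => y; exact: sqr_ge0.
have D0 : 0 <= D by apply: EL_ge0 => y; exact: sqr_ge0.
have [De|Dn] := eqVneq D 0.
  have [->|Cn] := eqVneq C 0; first by rewrite expr2 mul0r mulr_ge0.
  (* For D = 0 the polynomial is affine and takes the value -1 at this point. *)
  have := P (- (A + 1) / (2 * C)); rewrite De mulr0 addr0.
  rewrite (_ : 2 * _ * C = - (A + 1)); last by field.
  lra.
have Dg : 0 < D by rewrite lt_neqAle eq_sym Dn.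
have := mulr_ge0 D0 (P (- C / D)).
rewrite (_ : D * _ = A * D - C ^+ 2); last by field.
by rewrite subr_ge0.
Qed.

(** * Expectation over the product space, and kernels *)

Lemma Exp_Ei i F : Exp mu (Ei mu i F) = Exp mu F.
Proof.
rewrite /Exp /Ei; under eq_bigr do rewrite mulr_sumr.
rewrite pair_big /=.
(* Exchanging coordinate [i] with the fresh sample preserves the joint weight and turns the
   resampled point back into the original one. *)
pose sw (p : pt Omega n * Omega) := (upd p.1 i p.2, p.1 i).
have swK : involutive sw.
  by case=> x a; rewrite /sw /= upd_upd upd_id ffunE eqxx.
rewrite (reindex_inj (inv_inj swK)) /=.
rewrite -(pair_big xpredT xpredT
  (fun x a => mun mu (upd x i a) * (mu (x i) * F (upd (upd x i a) i (x i))))) /=.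
apply: eq_bigr => x _.
transitivity (\sum_a mu a * (mun mu x * F x)); last by rewrite -mulr_suml mu_sum1 mul1r.
apply: eq_bigr => a _; rewrite upd_upd upd_id !mulrA; congr (_ * _).
rewrite /mun (bigD1 i) //= [in RHS](bigD1 i) //= ffunE eqxx mulrA mulrAC; congr (_ * _).
by apply: eq_bigr => j ji; rewrite ffunE (negbTE ji).
Qed.

Lemma Exp_EL l F : Exp mu (EL l F) = Exp mu F.
Proof. by elim: l => //= i l IH; rewrite Exp_Ei. Qed.

Lemma mun_ge0 x : 0 <= mun mu x.
Proof. exact: prodr_ge0. Qed.

Lemma Exp_le F G : (forall x, F x <= G x) -> Exp mu F <= Exp mu G.
Proof. by move=> FG; apply: ler_sum => x _; rewrite ler_wpM2l ?mun_ge0. Qed.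

Lemma Exp_ge0 F : (forall x, 0 <= F x) -> 0 <= Exp mu F.
Proof. by move=> F0; apply: sumr_ge0 => x _; rewrite mulr_ge0 ?mun_ge0. Qed.

Lemma ExpD F G : Exp mu (fun x => F x + G x) = Exp mu F + Exp mu G.
Proof. by rewrite -big_split; apply: eq_bigr => x _; rewrite mulrDr. Qed.

Lemma ExpZ k F : Exp mu (fun x => k * F x) = k * Exp mu F.
Proof. by rewrite /Exp mulr_sumr; apply: eq_bigr => x _; rewrite mulrCA. Qed.

Lemma sum_mun : \sum_(x : pt Omega n) mun mu x = 1.
Proof.
rewrite /mun -(bigA_distr_bigA (fun _ : 'I_n => mu)) /=.
by apply: big1 => i _.
Qed.

(** Turns iterated averages into one expectation over a full point, the form in which [norm2] of
    [DSx] is given. *)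
Lemma EL_merge l F x : uniq l ->
  EL l F x = Exp mu (fun z => F [ffun j => if j \in l then z j else x j]).
Proof.
elim: l x => [|i l IH] x /= => [_|/andP[il ul]].
  rewrite /Exp (eq_bigr (fun z => mun mu z * F x)).
    by rewrite -mulr_suml sum_mun mul1r.
  by move=> z _; congr (_ * F _); apply/ffunP => j; rewrite ffunE.
rewrite -[RHS](Exp_Ei i) {1}/Ei; under eq_bigr do rewrite IH // -ExpZ.
rewrite /Exp exchange_big /=; apply: eq_bigr => z _; rewrite -mulr_sumr.
congr (_ * _); apply: eq_bigr => a _; congr (_ * F _); apply/ffunP => j.
by rewrite !ffunE inE; case: eqP => //= ->; rewrite (negbTE il).
Qed.

(** Outside [l] the kernel is a point mass in each coordinate; for the full list it is the kernel of
    [Trho]. *)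
Lemma foldr_noise l s f x : uniq l ->
  foldr (noise s) f l x = \sum_(y : pt Omega n) (\prod_i (if i \in l
     then s * (x i == y i)%:R + (1 - s) * mu (y i) else (x i == y i)%:R)) * f y.
Proof.
elim: l x => [|i l IH] x /= => [_|/andP[il ul]].
  rewrite (bigD1 x) //= big1 => [|i _]; last by rewrite eqxx.
  rewrite mul1r big1 ?addr0 // => y yx.
  have /existsP[i xyi] : [exists i, x i != y i].
    rewrite -negb_forall; apply: contra yx => /forallP xy.
    by apply/eqP/ffunP => i; rewrite (eqP (xy i)).
  by rewrite (bigD1 i) //= (negbTE xyi) !mul0r.
rewrite (_ : noise s i _ x = s * foldr (noise s) f l x +
  (1 - s) * \sum_a mu a * foldr (noise s) f l (upd x i a)) // IH // mulr_sumr.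
under [X in _ + _ * X]eq_bigr do rewrite IH // mulr_sumr.
rewrite exchange_big /= mulr_sumr -big_split /=; apply: eq_bigr => y _.
set K := fun (x : pt Omega n) j => if j \in l
  then s * (x j == y j)%:R + (1 - s) * mu (y j) else (x j == y j)%:R.
pose P x := \prod_j K x j.
have PE a : P (upd x i a) = (a == y i)%:R * \prod_(j | j != i) K x j.
  rewrite /P (bigD1 i) //= {1}/K (negbTE il) ffunE eqxx; congr (_ * _).
  by apply: eq_bigr => j ji; rewrite /K ffunE (negbTE ji).
transitivity (s * (P x * f y) + (1 - s) * \sum_a mu a * (P (upd x i a) * f y)) => //.
have := PE (x i); rewrite upd_id => ->; under [X in _ + _ * X]eq_bigr do rewrite PE.
rewrite [in RHS](bigD1 i) //= inE eqxx /=.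
rewrite [in RHS](eq_bigr (K x)); last by move=> j ji; rewrite inE (negbTE ji).
set Q := \prod_(j | j != i) K x j.
rewrite (bigD1 (y i)) //= eqxx big1 ?addr0; last first.
  by move=> a /negbTE ->; rewrite !mul0r mulr0.
by rewrite (_ : true%:R = 1 :> R) //; ring.
Qed.

(** * Second moments under noise *)

Lemma Ei_noise_sqr s i g x :
  Ei mu i (fun y => noise s i g y ^+ 2) x =
  Ei mu i g x ^+ 2 + s ^+ 2 * Ei mu i (fun y => Li mu i g y ^+ 2) x.
Proof.
(* Orthogonality: the cross term vanishes because [Ei mu i g] is constant in coordinate [i] and
   [Li mu i g] has mean zero there. *)
rewrite (_ : (fun y => noise s i g y ^+ 2) = fun y =>
  Ei mu i g y * Ei mu i g y + 2 * s * (Ei mu i g y * Li mu i g y)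
  + s ^+ 2 * Li mu i g y ^+ 2); last by apply: funext => y; rewrite noiseE; ring.
rewrite !EiD !EiZ !(Ei_mull i (Ei mu i g)); try exact: Ei_upd.
by rewrite Ei_Li mulr0 mulr0 addr0 [Ei mu i (Ei mu i g) x]Ei_invariant ?expr2 //; exact: Ei_upd.
Qed.

Lemma noise1 i g : noise 1 i g = g.
Proof. by apply: funext => x; rewrite noiseE /Li; ring. Qed.

Lemma Ei_noise_sqr_le s i g x : s ^+ 2 <= 1 ->
  Ei mu i (fun y => noise s i g y ^+ 2) x <= Ei mu i (fun y => g y ^+ 2) x.
Proof.
move=> s1; rewrite -[in leRHS](noise1 i g) !Ei_noise_sqr lerD2l.
apply: ler_wpM2r; last by rewrite expr1n.
by apply: sumr_ge0 => a _; rewrite mulr_ge0 ?sqr_ge0.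
Qed.

Lemma EL_noise_sqr_le s l g x : s ^+ 2 <= 1 ->
  EL l (fun y => foldr (noise s) g l y ^+ 2) x <= EL l (fun y => g y ^+ 2) x.
Proof.
move=> s1; elim: l x => [|i l IH] x //=.
rewrite -[leLHS]/(Ei mu i (EL l _) x) Ei_EL.
apply: le_trans (EL_le l _ _ (fun y => Ei_noise_sqr_le s i _ y s1) x) _.
by rewrite -Ei_EL; apply: Ei_le.
Qed.

Lemma Exp_noise_sqr s i g : Exp mu (fun y => noise s i g y ^+ 2) =
  Exp mu (fun y => Ei mu i g y ^+ 2) + s ^+ 2 * Exp mu (fun y => Li mu i g y ^+ 2).
Proof.
rewrite -(Exp_Ei i) (funext (Ei_noise_sqr s i g)) ExpD ExpZ.
by congr (_ + _ * _); rewrite Exp_Ei.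
Qed.

(** One-coordinate Parseval: this noise loses exactly half the energy of [Li mu i g], and the second
    term restores it. *)
Lemma Exp_noise_half_sqr s i g : s ^+ 2 = 2^-1 ->
  Exp mu (fun y => noise s i g y ^+ 2) + 2^-1 * Exp mu (fun y => Li mu i g y ^+ 2)
  = Exp mu (fun y => g y ^+ 2).
Proof.
by move=> s2; rewrite -[in RHS](noise1 i g) !Exp_noise_sqr s2; field.
Qed.

(* One coordinate is moved from the noise side to the L2 side; the tangent
   line of [u `^ (q / 2)] absorbs the quadratic term of [powR_sum_le]. *)
Lemma Ei_noise_powR_le q s t i l g x : 2 <= q -> 0 < s -> s <= 1 / 3 -> t ^+ 2 = 2^-1 ->
  Ei mu i (fun y => EL l (fun z => noise (s / Num.sqrt (2 * q)) i g z ^+ 2) y `^ (q / 2)) x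
  <= EL (i :: l) (fun z => noise t i g z ^+ 2) x `^ (q / 2)
   + (s * (1 + 2 * (q - 2) / ln (1 / s)) / Num.sqrt (2 * q)) `^ q
     * Ei mu i (fun y => EL l (fun z => Li mu i g z ^+ 2) y `^ (q / 2)) x.
Proof.
move=> q2 s0 s3 t2; set k := Num.sqrt (2 * q); set b := s * (1 + _).
have b0 : 0 <= b.
  rewrite mulr_ge0 ?(ltW s0) // addr_ge0 // divr_ge0 //; first lra.
  by apply: ln_ge0; rewrite ler_pdivlMr //; lra.
have k2 : k ^+ 2 = 2 * q by rewrite sqr_sqrtr //; lra.
have k0 : 0 < k by rewrite sqrtr_gt0; lra.
have kn0 : k != 0 by rewrite gt_eqF.
pose A := EL l (fun z => Ei mu i g z ^+ 2).
pose C := EL l (fun z => Ei mu i g z * Li mu i g z).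
pose D := EL l (fun z => Li mu i g z ^+ 2).
have A0 y : 0 <= A y by apply: EL_ge0 => z; exact: sqr_ge0.
have D0 y : 0 <= D y by apply: EL_ge0 => z; exact: sqr_ge0.
have Ai y a : A (upd y i a) = A y.
  by apply: EL_upd_invariant => z c; rewrite Ei_upd.
(* The first-order term averages out over coordinate [i]. *)
have EC : Ei mu i C x = 0.
  rewrite Ei_EL (_ : Ei mu i _ = fun=> 0 * 0); last first.
    by apply: funext => z; rewrite Ei_mull ?Ei_Li ?mulr0 // => y a; exact: Ei_upd.
  by rewrite ELZ mul0r.
have noise_sqr r y : EL l (fun z => noise r i g z ^+ 2) y = A y + 2 * r * C y + r ^+ 2 * D y.
  by rewrite -EL_sqrD; congr (EL l _ y); apply: funext => z; rewrite noiseE.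
have -> : EL (i :: l) (fun z => noise t i g z ^+ 2) x = A x + 2^-1 * Ei mu i D x.
  rewrite -[LHS]/(Ei mu i (EL l _) x) (_ : EL l _ = fun y => A y + 2 * t * C y + t ^+ 2 * D y).
    by rewrite !EiD !EiZ EC mulr0 addr0 Ei_invariant ?t2.
  by apply: funext => y; exact: noise_sqr.
set p := q / 2; set c := (b / k) `^ q.
(* [powR_sum_le] is applied to the Laplacian part divided by [k]; as k^2 = 2q, the coefficient q^2/2
   becomes q/4. The factor [1] gives the first term the product shape that [Ei_mull] expects. *)
have step y : EL l (fun z => noise (s / k) i g z ^+ 2) y `^ p <=
   A y `^ p * 1 + A y `^ (p - 1) * (q * s / k * C y + q / 4 * D y) + c * D y `^ p.
  have CS : (C y / k) ^+ 2 <= A y * (D y / k ^+ 2).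
    rewrite expr_div_n mulrA; apply: ler_wpM2r; first by rewrite invr_ge0 sqr_ge0.
    exact: EL_CauchySchwarz.
  have := powR_sum_le q s (A y) (C y / k) (D y / k ^+ 2) q2 s0 s3 (A0 y)
    (divr_ge0 (D0 y) (sqr_ge0 k)) CS.
  rewrite -/b -/p noise_sqr.
  rewrite (_ : A y + 2 * s * (C y / k) + s ^+ 2 * (D y / k ^+ 2) =
     A y + 2 * (s / k) * C y + (s / k) ^+ 2 * D y); last by field.
  rewrite (_ : q * s * (C y / k) + q ^+ 2 / 2 * (D y / k ^+ 2) =
     q * s / k * C y + q / 4 * D y); last by rewrite k2; field; rewrite kn0 gt_eqF //; lra.
  rewrite mulr1 (_ : b `^ q * (D y / k ^+ 2) `^ p = c * D y `^ p) //.
  rewrite powRM ?invr_ge0 ?sqr_ge0 // -exprVn -powR_mulrn ?invr_ge0 ?(ltW k0) //.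
  rewrite -powRrM (_ : 2%:R * p = q); last by rewrite /p; field.
  rewrite /c [(b / k) `^ q]powRM ?invr_ge0 ?(ltW k0) //; ring.
apply: le_trans (Ei_le i _ _ x step) _.
have Ap u y a : A (upd y i a) `^ u = A y `^ u by rewrite Ai.
rewrite !EiD !EiZ (Ei_mull i (fun y => A y `^ p)) // (Ei_mull i (fun y => A y `^ (p - 1))) //.
rewrite EiD !EiZ EC mulr0 add0r Ei_invariant // mulr1 lerD2r.
have ED0 : 0 <= Ei mu i D x by apply: sumr_ge0 => a _; rewrite mulr_ge0.
have p1 : 1 <= p by rewrite /p; lra.
have h0 : 0 <= 2^-1 * Ei mu i D x by rewrite mulr_ge0 // invr_ge0.
(* Since q/4 = p/2, the tangent at [A x] with increment half of [Ei mu i D x] has exactly the right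
   slope term. *)
have := powR_tangent p (A x) _ p1 (A0 x) (addr_ge0 (A0 x) h0); rewrite /p; lra.
Qed.

(** [LS] folds over [enum], while the induction collects coordinates in its own order; commutation
    reconciles the two. *)
Lemma foldr_perm (T : Type) (I : eqType) (g : I -> T -> T) (u : T) (s1 s2 : seq I) :
  (forall a b v, g a (g b v) = g b (g a v)) -> perm_eq s1 s2 ->
  foldr g u s1 = foldr g u s2.
Proof.
move=> gC; elim: s1 s2 => [|k s1 IH] s2; first by move/perm_size; case: s2.
move=> ps; have ks2 : k \in s2 by rewrite -(perm_mem ps) mem_head.
move: ps; have [a b] := splitPr ks2.
rewrite perm_sym -[k :: b]cat1s perm_catCA perm_sym perm_cons => /IH /= ->.
by rewrite !foldr_cat /=; apply: foldr_commute => c v; exact: gC.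
Qed.

(** * Induction over the coordinates *)

Section Induction.
Variables (f : pt Omega n -> R) (q s r gamma t : R).
Hypotheses (q2 : 2 <= q) (s0 : 0 < s) (s3 : s <= 1 / 3) (t2 : t ^+ 2 = 2^-1).
Hypotheses (r0 : 0 < r) (gamma0 : 0 < gamma) (f_global : L2_global mu r gamma f).

Let c := (s * (1 + 2 * (q - 2) / ln (1 / s)) / Num.sqrt (2 * q)) `^ q.
Hypothesis cr : c * r `^ (q - 2) <= 2^-1.

(** As [B] and [S] partition the coordinates, averaging over [B] with [S] frozen at [x] gives the
    squared norm of [DSx]. *)
Lemma L2_global_EL B S x : perm_eq (B ++ S) (enum 'I_n) ->
  EL B (fun y => foldr (@Li R Omega mu n) f S y ^+ 2) x <= (r ^+ size S * gamma) ^+ 2.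
Proof.
move=> BS; have uBS : uniq (B ++ S) by rewrite (perm_uniq BS) enum_uniq.
have [uB dBS uS] : [/\ uniq B, ~~ has (mem B) S & uniq S].
  by move: uBS; rewrite cat_uniq => /and3P[].
have inBS j : (j \in B) || (j \in S) by rewrite -mem_cat (perm_mem BS) mem_enum.
pose T := [set j in S].
have LST : LS mu T f = foldr (@Li R Omega mu n) f S.
  have pST : perm_eq (enum T) S.
    by apply: uniq_perm; rewrite ?enum_uniq // => j; rewrite mem_enum inE.
  rewrite /LS; apply: foldr_perm => // a b u; rewrite !LiE; exact: affEC.
have -> : EL B (fun y => foldr (@Li R Omega mu n) f S y ^+ 2) x
    = norm2 mu (DSx mu T x f) ^+ 2.
  rewrite EL_merge // sqr_sqrtr; last by apply: Exp_ge0 => y; exact: sqr_ge0.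
  congr (Exp mu _); apply: funext => z; rewrite /DSx LST; congr (foldr _ _ _ _ ^+ 2).
  apply/ffunP => j; rewrite !ffunE inE.
  have := inBS j; case: (boolP (j \in S)) => jS; last by rewrite orbF => ->.
  by have /negbTE -> : j \notin B := hasPn dBS j jS.
have -> : size S = #|T| by rewrite cardsE; apply/esym/card_uniqP.
rewrite ler_sqr ?nnegrE ?sqrtr_ge0 ?f_global //.
by rewrite mulr_ge0 ?exprn_ge0 ?ltW.
Qed.

(** The noise of rate [t] is kept on [B] so that [Exp_noise_half_sqr] can recombine the two choices
    exactly. *)
Let mixed B S := foldr (noise t) (foldr (@Li R Omega mu n) f S) B.

Lemma Exp_noise_powR_le l B S : perm_eq (l ++ B ++ S) (enum 'I_n) ->
  c ^+ size S * Exp mu (fun x =>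
    EL B (fun z => foldr (noise (s / Num.sqrt (2 * q))) (mixed B S) l z ^+ 2) x `^ (q / 2))
  <= gamma `^ (q - 2) * 2^-1 ^+ size S * Exp mu (fun x => mixed B S x ^+ 2).
Proof.
elim: l B S => [|i l IH] B S BS; set h := mixed B S.
  have c0 : 0 <= c by exact: powR_ge0.
  (* Split N^(q/2) as N^(q/2-1) N: globalness bounds the first factor uniformly, and the expectation
     of the second is a squared L2 norm. *)
  have h2 x : EL B (fun z => h z ^+ 2) x `^ (q / 2) <=
     ((r ^+ size S * gamma) ^+ 2) `^ (q / 2 - 1) * EL B (fun z => h z ^+ 2) x.
    have h0 : 0 <= EL B (fun z => h z ^+ 2) x by apply: EL_ge0 => z; exact: sqr_ge0.
    rewrite -mulr_powRB1 //; last by move: q2; lra.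
    rewrite mulrC ler_wpM2r //; apply: ge0_ler_powR; rewrite ?nnegrE ?sqr_ge0 //.
      by move: q2; lra.
    (* The noise on [B] does not increase the inner norm. *)
    apply: le_trans (L2_global_EL B S x BS); apply: EL_noise_sqr_le; rewrite t2; lra.
  apply: (@le_trans _ _ (c ^+ size S * (((r ^+ size S * gamma) ^+ 2) `^ (q / 2 - 1)
      * Exp mu (fun x => h x ^+ 2)))).
    rewrite ler_wpM2l ?exprn_ge0 // -[in leRHS](Exp_EL B) -ExpZ; exact: Exp_le.
  rewrite mulrA ler_wpM2r //; first by apply: Exp_ge0 => z; exact: sqr_ge0.
  have rg0 : 0 <= r ^+ size S * gamma by rewrite mulr_ge0 ?exprn_ge0 ?ltW.
  rewrite -(powR_mulrn 2 rg0) -powRrM (_ : 2%:R * (q / 2 - 1) = q - 2); last by field.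
  rewrite powRM ?exprn_ge0 ?(ltW r0) ?(ltW gamma0) // -(powR_mulrn _ (ltW r0)) powRAC.
  rewrite powR_mulrn ?powR_ge0 // mulrA -exprMn mulrC ler_wpM2l ?powR_ge0 //.
  by rewrite lerXn2r ?nnegrE ?mulr_ge0 ?powR_ge0 // invr_ge0.
pose k := Num.sqrt (2 * q); rewrite -/k.
pose g := foldr (noise (s / k)) h l.
have BSl : perm_eq (l ++ (i :: B) ++ S) (enum 'I_n).
  by apply: perm_trans BS; rewrite -[(i :: B) ++ S]/([:: i] ++ B ++ S) perm_catCA.
have BSr : perm_eq (l ++ B ++ (i :: S)) (enum 'I_n).
  apply: perm_trans BS; rewrite catA -[i :: S]/([:: i] ++ S) perm_catCA.
  by rewrite -catA.
(* Operators on coordinate [i] move past the noise on [l], which gives both branches the shape of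
   the induction hypothesis. *)
have gN : noise t i g = foldr (noise (s / k)) (noise t i h) l.
  by apply: foldr_commute => j u; exact: affEC.
have gL : Li mu i g = foldr (noise (s / k)) (Li mu i h) l.
  by apply: foldr_commute => j u; rewrite !LiE; exact: affEC.
have hL : Li mu i h = mixed B (i :: S).
  by apply: foldr_commute => j u; rewrite !LiE; exact: affEC.
have := IH _ _ BSl; rewrite -[mixed (i :: B) S]/(noise t i h) -gN; set I1 := Exp mu _ => H1.
have := IH _ _ BSr; rewrite -hL -gL; set I2 := Exp mu _ => H2.
have c0 : 0 <= c ^+ size S by rewrite exprn_ge0 // powR_ge0.
apply: (@le_trans _ _ (c ^+ size S * (I1 + c * I2))).
  apply: ler_wpM2l => //; rewrite -[leLHS](Exp_Ei i).
  rewrite -[I2](Exp_Ei i) -ExpZ -ExpD; apply: Exp_le => x; exact: Ei_noise_powR_le.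
(* The extra 1/2 earned by enlarging [S] is the weight that Parseval requires. *)
rewrite -(Exp_noise_half_sqr t i h t2).
move: H1 H2; rewrite /= !exprS.
set u := Exp mu _; set v := Exp mu _; set c' := c ^+ _; set w := 2^-1 ^+ _.
move=> H1 H2; lra.
Qed.

End Induction.

End Operators.
End GlobalHypercontractivity.

(** * Conclusion from the induction *)

Theorem mainTheorem9 (R : realType) (Omega : finType) (mu : Omega -> R) (n : nat)
  (r gamma q rho' : R) (f : pt Omega n -> R) :
  prob_space mu ->
  0 < r -> 0 < gamma -> 2 <= q ->
  L2_global mu r gamma f ->
  0 < rho' -> rho' <= 1 / 3 ->
  rho' * (1 + 2 * (q - 2) / ln (1 / rho'))
    <= Num.sqrt q * (r / Num.sqrt 2) `^ (- ((q - 2) / q)) ->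
  normq_pow mu q (Trho mu (rho' / Num.sqrt (2 * q)) f)
    <= norm2 mu f ^+ 2 * gamma `^ (q - 2).
Proof.
move=> [mu_ge0 mu_sum1] r0 gamma0 q2 f_global s0 s3 hb.
set k := Num.sqrt (2 * q); set b := rho' * _ in hb.
pose m : R := Num.sqrt 2; pose u := r / m.
have m0 : 0 < m by rewrite sqrtr_gt0.
have u0 : 0 < u by rewrite divr_gt0.
have q0 : 0 < q by lra.
have sq0 : 0 < Num.sqrt q by rewrite sqrtr_gt0.
have kE : k = m * Num.sqrt q by rewrite -sqrtrM.
have b0 : 0 <= b.
  have L0 : 0 <= ln (1 / rho') by apply: ln_ge0; rewrite ler_pdivlMr //; lra.
  have B0 : 0 <= 2 * (q - 2) / ln (1 / rho') by apply: divr_ge0 => //; lra.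
  rewrite mulr_ge0 ?(ltW s0) //; lra.
(* The hypothesis bounds b/k by u^(-(q-2)/q)/m; its q-th power times (um)^(q-2) is m^(-2) = 1/2. *)
have cr : (b / k) `^ q * r `^ (q - 2) <= 2^-1.
  have bk : b / k <= u `^ (- ((q - 2) / q)) * m^-1.
    rewrite kE ler_pdivrMr ?mulr_gt0 // mulrA mulfVK ?gt_eqF //.
    by rewrite mulrC.
  have k0 : 0 < k by rewrite kE mulr_gt0.
  apply: (@le_trans _ _ ((u `^ (- ((q - 2) / q)) * m^-1) `^ q * r `^ (q - 2))).
    rewrite ler_wpM2r ?powR_ge0 //; apply: ge0_ler_powR; rewrite ?nnegrE ?(ltW q0) //.
      by rewrite divr_ge0 // ltW.
    by rewrite mulr_ge0 ?powR_ge0 ?invr_ge0 ?(ltW m0).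
  have -> : r = u * m by rewrite /u mulfVK ?gt_eqF.
  rewrite powRM ?powR_ge0 ?invr_ge0 ?(ltW m0) // powRM ?(ltW u0) ?(ltW m0) //.
  rewrite -powRrM mulNr mulfVK ?gt_eqF // mulrACA -powRD; last by rewrite (gt_eqF u0) implybT.
  rewrite addNr powRr0 mul1r -powR_inv1 ?(ltW m0) // -powRrM mulN1r.
  rewrite -powRD; last by rewrite (gt_eqF m0) implybT.
  rewrite (_ : - q + (q - 2) = - 2%:R); last by ring.
  by rewrite powR_invn ?(ltW m0) // sqr_sqrtr.
pose t : R := Num.sqrt 2^-1.
have t2 : t ^+ 2 = 2^-1 by rewrite sqr_sqrtr // invr_ge0.
(* At the start [B] and [S] are empty: the inner average is trivial and (g^2)^(q/2) = |g|^q. *)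
have perm0 : perm_eq (enum 'I_n ++ [::] ++ [::]) (enum 'I_n) by rewrite !cats0.
have := @Exp_noise_powR_le R Omega mu n mu_ge0 mu_sum1 f q rho' r gamma t
  q2 s0 s3 t2 r0 gamma0 f_global cr _ _ _ perm0.
rewrite !expr0 mul1r mulr1 [_ * Exp _ _]mulrC => H.
rewrite /norm2 sqr_sqrtr; last by apply: Exp_ge0 => // x; exact: sqr_ge0.
apply: le_trans H; rewrite le_eqVlt; apply/orP; left; apply/eqP.
congr (Exp mu _); apply: funext => x.
rewrite /EL /= foldr_noise ?enum_uniq // -(real_normK (num_real _)).
rewrite -powR_mulrn ?normr_ge0 // -powRrM (_ : 2%:R * (q / 2) = q); last by field.
congr (`|_| `^ _); apply: eq_bigr => y _; congr (_ * _).
by apply: eq_bigr => i _; rewrite mem_enum.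
Qed.
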